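(* Let $f,g:\mathbb{R}^m\times\mathbb{R}^n\to\mathbb{R}$ satisfy the standing assumptions (A1)--(A3) listed in the context, with constants $\mu_g,L_g,\mu_f,H_\omega,H_v,H>0$. Let $\omega^*$ be the minimizer of $f_*$. Let the step sizes $\alpha,\beta>0$ satisfy $$\alpha<\min\left\{\frac{\mu_f}{8\left(H_\omega^2+\frac{2H_v^2H^2}{\mu_g^2}\right)},\ \frac{1}{24\mu_f}\right\},\qquad \beta<\min\left\{\frac{\mu_g}{8L_g^2},\ \frac{1}{4\mu_g}\right\},\qquad \frac{\alpha}{\beta^2}<\frac{2\mu_f\mu_g^4}{81H_v^2H^2}.$$ Then the iterates of the single-loop algorithm $$\omega_{k+1}=\omega_k-\alpha\tilde\nabla f(\omega_k,v_k),\qquad v_{k+1}=v_k-\beta\nabla_v g(\omega_k,v_k)$$ converge linearly to $(\omega^*,v_*(\omega^* ))$. Precisely, there exist $\rho\in(0,1)$ with $$\rho\le\max\left\{\sqrt{1-\frac{3\mu_f\alpha}{4}\left(1-\frac{8\left(H_\omega^2+2\frac{H_v^2H^2}{\mu_g^2}\right)\alpha}{\mu_f}\right)},\ \sqrt{1-\frac{\mu_g\beta}{2}\left(1-\frac{4L_g^2\beta}{\mu_g}\right)}\right\}$$ and constants $c_\omega,c_v>0$ such that for all initial points $(\omega_0,v_0)\in\mathbb{R}^m\times\mathbb{R}^n$ and all $k\ge 0$, $$\|\omega_k-\omega^*\|_2\le c_\omega\rho^k\left(\|\omega_0-\omega^*\|_2+\|v_0-v_*(\omega_0)\|_2\right),$$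 $$\|v_k-v_*(\omega^* )\|_2\le c_v\rho^k\left(\|\omega_0-\omega^*\|_2+\|v_0-v_*(\omega_0)\|_2\right).$$
   Context: Setting: $f$ is continuously differentiable and $g$ is twice continuously differentiable on $\mathbb{R}^m\times\mathbb{R}^n$, with variables $(\omega,v)$. The bilevel problem is to minimize $f(\omega,v)$ over $\omega$ subject to $v\in\arg\min_{v} g(\omega,v)$. $\|\cdot\|_2$ is the Euclidean norm for vectors and the induced operator norm for matrices. Notation: $\nabla^2_{vv}g$ is the Hessian of $g$ in $v$; $\nabla^2_{\omega v}g=\frac{\partial}{\partial\omega}\frac{\partial}{\partial v}g$ is the $m\times n$ matrix with entries $\partial^2 g/\partial\omega_i\partial v_j$. Under (A1), $v_*(\omega)$ denotes the unique minimizer of $g(\omega,\cdot)$, and $f_*(\omega):=f(\omega,v_*(\omega))$. The approximated gradient is $$\tilde\nabla f(\omega,v):=\nabla_\omega f(\omega,v)-\nabla^2_{\omega v}g(\omega,v)\,[\nabla^2_{vv}g(\omega,v)]^{-1}\,\nabla_v f(\omega,v).$$ Assumptions: (A1) For every $\omega$, $g(\omega,\cdot)$ is $\mu_g$-strongly convex, i.e. $g(\omega,v')\ge g(\omega,v)+\langle\nabla_v g(\omega,v),v'-v\rangle+\frac{\mu_g}{2}\|v'-v\|_2^2$ for all $v,v'$, and $L_g$-smooth, i.e. $\|\nabla_v g(\omega,v)-\nabla_v g(\omega,v')\|_2\le L_g\|v-v'\|_2$ for all $v,v'$. (A2) $f_*$ is $\mu_f$-strongly convex (same definition), and for all $\omega,\omega',v,v'$: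 $\|\tilde\nabla f(\omega,v)-\tilde\nabla f(\omega',v)\|_2\le H_\omega\|\omega-\omega'\|_2$ and $\|\tilde\nabla f(\omega,v)-\tilde\nabla f(\omega,v')\|_2\le H_v\|v-v'\|_2$. (A3) $\|\nabla^2_{\omega v}g(\omega,v)\|_2<H$ for all $\omega,v$. *)

(* Defs.v *)
(* Vectors of R^k are the column vectors 'cV[R]_k. *)
From HB Require Import structures.
From mathcomp Require Import all_boot all_order all_algebra.
From mathcomp Require Import all_classical all_reals all_analysis.

Set Implicit Arguments.
Unset Strict Implicit.
Unset Printing Implicit Defensive.

Import Order.TTheory GRing.Theory Num.Theory.
Import numFieldNormedType.Exports.

Local Open Scope classical_set_scope.
Local Open Scope ring_scope.

(* MathComp-Analysis norms 'cV[R]_k by the maximum norm, and products by the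
   maximum of the norms.  The topology and the notions of differentiability are
   those of the Euclidean norm, but every norm in an estimate has to be the
   Euclidean one, so it is defined here. *)
Definition dot (R : realType) (k : nat) (x y : 'cV[R]_k) : R :=
  \sum_(i < k) x i 0 * y i 0.

Definition norm2 (R : realType) (k : nat) (x : 'cV[R]_k) : R :=
  Num.sqrt (dot x x).

Definition opnorm2 (R : realType) (p q : nat) (A : 'M[R]_(p, q)) : R :=
  sup [set norm2 (A *m x) | x in [set x : 'cV[R]_q | norm2 x <= 1]].

(* The domains used are finite dimensional, where continuity of x |-> 'D_u F x
   for every fixed u is continuity of the differential. *)
Definition C1 (R : realType) (U : normedModType R) (F : U -> R) : Prop :=
  (forall x, differentiable F x) /\ (forall u, continuous ('D_u F)).

Definition C2 (R : realType) (U : normedModType R) (F : U -> R) : Prop :=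
  C1 F /\ (forall u, C1 ('D_u F)).

Definition grad (R : realType) (k : nat) (F : 'cV[R]_k -> R) (x : 'cV[R]_k) :
    'cV[R]_k :=
  \col_(i < k) 'D_(delta_mx i 0) F x.

Definition strongly_convex (R : realType) (k : nat) (mu : R)
    (F : 'cV[R]_k -> R) : Prop :=
  forall x y,
    F y >= F x + dot (grad F x) (y - x) + mu / 2 * norm2 (y - x) ^+ 2.

Definition lipschitz2 (R : realType) (p q : nat) (L : R)
    (F : 'cV[R]_p -> 'cV[R]_q) : Prop :=
  forall x y, norm2 (F x - F y) <= L * norm2 (x - y).

Definition smooth (R : realType) (k : nat) (L : R) (F : 'cV[R]_k -> R) : Prop :=
  lipschitz2 L (grad F).

Definition is_minimizer (R : realType) (k : nat) (F : 'cV[R]_k -> R)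
    (x : 'cV[R]_k) : Prop :=
  forall y, F x <= F y.

(* [get] picks an element of the set of minimizers, and is a junk value if that
   set is empty. *)
Definition argmin (R : realType) (k : nat) (F : 'cV[R]_k -> R) : 'cV[R]_k :=
  get [set x | is_minimizer F x].

Definition grad_w (R : realType) (m n : nat) (h : 'cV[R]_m * 'cV[R]_n -> R)
    (w : 'cV[R]_m) (v : 'cV[R]_n) : 'cV[R]_m :=
  grad (fun w' => h (w', v)) w.

Definition grad_v (R : realType) (m n : nat) (h : 'cV[R]_m * 'cV[R]_n -> R)
    (w : 'cV[R]_m) (v : 'cV[R]_n) : 'cV[R]_n :=
  grad (fun v' => h (w, v')) v.

Definition hess_vv (R : realType) (m n : nat) (h : 'cV[R]_m * 'cV[R]_n -> R)
    (w : 'cV[R]_m) (v : 'cV[R]_n) : 'M[R]_n :=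
  \matrix_(i < n, j < n) 'D_(delta_mx i 0) (fun v' => grad_v h w v' j 0) v.

Definition hess_wv (R : realType) (m n : nat) (h : 'cV[R]_m * 'cV[R]_n -> R)
    (w : 'cV[R]_m) (v : 'cV[R]_n) : 'M[R]_(m, n) :=
  \matrix_(i < m, j < n) 'D_(delta_mx i 0) (fun w' => grad_v h w' v j 0) w.

Definition vstar (R : realType) (m n : nat) (g : 'cV[R]_m * 'cV[R]_n -> R)
    (w : 'cV[R]_m) : 'cV[R]_n :=
  argmin (fun v => g (w, v)).

Definition fstar (R : realType) (m n : nat) (f g : 'cV[R]_m * 'cV[R]_n -> R)
    (w : 'cV[R]_m) : R :=
  f (w, vstar g w).

Definition tgrad (R : realType) (m n : nat) (f g : 'cV[R]_m * 'cV[R]_n -> R)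
    (w : 'cV[R]_m) (v : 'cV[R]_n) : 'cV[R]_m :=
  grad_w f w v - hess_wv g w v *m invmx (hess_vv g w v) *m grad_v f w v.

(* Main.v *)
(* Let e_k = w_k - w* and d_k = v_k - v*(w_k).  Implicit differentiation gives
   grad f*(w) = tgrad f g w (v*(w)), so the outer update is a gradient step for f*
   with an error at most H_v |d_k|, while the inner update is a gradient step
   towards v*(w_k) followed by the drift v*(w_k) - v*(w_{k+1}), where v* is
   H/mu_g-Lipschitz.  With the weight P = 2 mu_g^3 beta / (3 H^2), the Lyapunov
   function |e_k|^2 + P |d_k|^2 contracts by rho^2, where rho is the maximum of the
   two square roots in the statement: the step-size conditions absorb both
   coupling terms in the slack between the decoupled rates and rho^2.
   Existence of the minimizers comes from Banach's fixed point theorem applied to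
   a gradient step. *)
From HB Require Import structures.
Require Import Defs.
From mathcomp Require Import all_boot all_order all_algebra.
From mathcomp Require Import all_classical all_reals all_analysis.
From mathcomp Require Import ring lra.

Set Implicit Arguments.
Unset Strict Implicit.
Unset Printing Implicit Defensive.

Import Order.TTheory GRing.Theory Num.Theory.
Import numFieldNormedType.Exports.

Local Open Scope ring_scope.

(** Banach's theorem needs a complete normed module; this joins completeness and the norm on
    matrices. *)
HB.instance Definition _ (R : realType) (p q : nat) := Complete.on 'M[R]_(p, q).

(** * Euclidean inner product and norm *)

Section Euclidean.
Variables (R : realType) (k : nat).
Implicit Types (x y z : 'cV[R]_k) (a : R).

Lemma dotC x y : dot x y = dot y x.
Proof. by apply: eq_bigr => i _; rewrite mulrC. Qed.

Lemma dotDl x y z : dot (x + y) z = dot x z + dot y z.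
Proof. by rewrite /dot -big_split; apply: eq_bigr => i _; rewrite mxE mulrDl. Qed.

Lemma dotZl a x y : dot (a *: x) y = a * dot x y.
Proof. by rewrite /dot mulr_sumr; apply: eq_bigr => i _; rewrite mxE mulrA. Qed.

Lemma dotDr x y z : dot x (y + z) = dot x y + dot x z.
Proof. by rewrite dotC dotDl !(dotC x). Qed.

Lemma dotZr a x y : dot x (a *: y) = a * dot x y.
Proof. by rewrite dotC dotZl dotC. Qed.

Lemma dotNl x y : dot (- x) y = - dot x y.
Proof. by rewrite -scaleN1r dotZl mulN1r. Qed.

Lemma dotNr x y : dot x (- y) = - dot x y.
Proof. by rewrite dotC dotNl dotC. Qed.

Lemma dot0l x : dot 0 x = 0.
Proof. by rewrite -(scale0r 0) dotZl mul0r. Qed.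

Definition dotE := (dotDl, dotDr, dotNl, dotNr, dotZl, dotZr).

Lemma dot_delta x i : dot x (delta_mx i 0) = x i 0.
Proof.
rewrite /dot (bigD1 i) //= mxE !eqxx mulr1 big1 ?addr0 // => j /negPf ji.
by rewrite mxE ji mulr0.
Qed.

Lemma dot_ge0 x : 0 <= dot x x.
Proof. by apply: sumr_ge0 => i _; rewrite -expr2 sqr_ge0. Qed.

Lemma norm2_ge0 x : 0 <= norm2 x.
Proof. exact: sqrtr_ge0. Qed.

Lemma sqr_norm2 x : norm2 x ^+ 2 = dot x x.
Proof. by rewrite sqr_sqrtr ?dot_ge0. Qed.

Lemma norm2Z a x : norm2 (a *: x) = `|a| * norm2 x.
Proof. by rewrite /norm2 !dotE mulrA -expr2 sqrtrM ?sqr_ge0 // sqrtr_sqr. Qed.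

Lemma norm2N x : norm2 (- x) = norm2 x.
Proof. by rewrite /norm2 !dotE opprK. Qed.

Lemma norm2_distC x y : norm2 (x - y) = norm2 (y - x).
Proof. by rewrite -norm2N opprB. Qed.

Lemma norm2_0 : norm2 (0 : 'cV[R]_k) = 0.
Proof. by rewrite /norm2 dot0l sqrtr0. Qed.

Lemma entry_le_norm2 x i : `|x i 0| <= norm2 x.
Proof.
rewrite -sqrtr_sqr ler_sqrt ?dot_ge0 // /dot (bigD1 i) //= -expr2 lerDl.
by apply: sumr_ge0 => j _; rewrite -expr2 sqr_ge0.
Qed.

Lemma norm2_le0 x : (norm2 x <= 0) = (x == 0).
Proof.
apply/idP/eqP => [x0|->]; last by rewrite norm2_0.
apply/matrixP => i j; rewrite ord1 mxE; apply/eqP; rewrite -normr_le0.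
exact: le_trans (entry_le_norm2 x i) x0.
Qed.

(** The squared norm of [norm2 y *: x - norm2 x *: y] is [2 * norm2 x * norm2 y] times the gap
    between the two sides. If that factor vanishes, one of the vectors is zero. *)
Lemma cauchy_schwarz x y : dot x y <= norm2 x * norm2 y.
Proof.
have [ab|] := ltP 0 (norm2 x * norm2 y); last first.
  move=> ab; have /eqP : norm2 x * norm2 y = 0.
    by apply/eqP; rewrite eq_le ab mulr_ge0 ?norm2_ge0.
  rewrite mulf_eq0 => /orP[] /eqP h; move: (lexx (0 : R)); rewrite -{1}h norm2_le0.
    by move=> /eqP ->; rewrite dot0l norm2_0 mul0r.
  by move=> /eqP ->; rewrite dotC dot0l norm2_0 mulr0.
have := dot_ge0 (norm2 y *: x - norm2 x *: y).
rewrite !dotE (dotC y x) -!sqr_norm2 => h.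
rewrite -(ler_pM2l ab) -subr_ge0 -(pmulr_rge0 _ (ltr0n R 2)).
by apply: le_trans h _; rewrite le_eqVlt; apply/orP; left; apply/eqP; ring.
Qed.

Lemma cauchy_schwarz_norm x y : `|dot x y| <= norm2 x * norm2 y.
Proof.
rewrite ler_norml cauchy_schwarz andbT lerNl -dotNl.
by apply: le_trans (cauchy_schwarz _ _) _; rewrite norm2N.
Qed.

Lemma ler_norm2D x y : norm2 (x + y) <= norm2 x + norm2 y.
Proof.
rewrite -(@ler_pXn2r _ 2) ?nnegrE ?addr_ge0 ?norm2_ge0 //.
rewrite sqrrD !sqr_norm2 !dotE (dotC y x).
have := cauchy_schwarz x y; lra.
Qed.

Lemma ler_norm2_dist x y z : norm2 (x - z) <= norm2 (x - y) + norm2 (y - z).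
Proof. by rewrite -[x - z](subrKA y) ler_norm2D. Qed.

(** Together with [norm_le_norm2], this compares the Euclidean norm with the maximum norm [|x|]. The
    factor [k], instead of its square root, is crude but sufficient. *)
Lemma norm2_le x : norm2 x <= k%:R * `|x|.
Proof.
have ge0 : 0 <= k%:R * `|x| by rewrite mulr_ge0.
rewrite -(@ler_pXn2r _ 2) ?nnegrE ?norm2_ge0 // sqr_norm2 /dot.
have xi i : `|x i 0| <= `|x|.
  rewrite [leRHS]/Num.norm /= mx_normrE.
  by apply: (le_bigmax _ (fun j => `|x j.1 j.2|) (i, ord0)).
apply: (@le_trans _ _ (\sum_(i < k) `|x| ^+ 2)).
  by apply: ler_sum => i _; rewrite -expr2 -real_normK ?num_real // ler_pXn2r ?nnegrE.
rewrite sumr_const card_ord exprMn -[leLHS]mulr_natl ler_wpM2r ?sqr_ge0 //.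
by rewrite -natrX ler_nat; case: (k) => // j; rewrite expnS leq_pmulr.
Qed.

Lemma norm_le_norm2 x : `|x| <= norm2 x.
Proof.
rewrite [leLHS]/Num.norm /= mx_normrE; apply: bigmax_le => [|[i j] _ /=].
  exact: norm2_ge0.
by rewrite ord1 entry_le_norm2.
Qed.

End Euclidean.

(** * Strong convexity, contractions and existence of minimizers *)

Section StrongConvexity.
Local Open Scope classical_set_scope.
Local Open Scope ring_scope.
Variables (R : realType) (k : nat).
Implicit Types (x y : 'cV[R]_k) (G T : 'cV[R]_k -> 'cV[R]_k) (F : 'cV[R]_k -> R).

(* The contraction factor is Euclidean, whereas completeness is that of the
   maximum norm; a high iterate of [T] contracts the latter as well. *)
Lemma contraction2_fixpoint T (q : R) : 0 <= q < 1 -> lipschitz2 q T ->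
  exists x, T x = x.
Proof.
move=> /andP[q0 q1] Tq.
have iterq N : lipschitz2 (q ^+ N) (iter N T).
  elim: N => [|N IH] x y; first by rewrite expr0 mul1r.
  by rewrite !iterS (le_trans (Tq _ _)) // exprS -mulrA ler_wpM2l.
(* The factor [k.+1] pays for the change between the two norms and is nonzero even in dimension
   zero. *)
have [N qN] : exists N, q ^+ N * k.+1%:R < 1.
  have : (fun n => q ^+ n) @ \oo --> (0 : R) by apply: cvg_expr; rewrite ger0_norm.
  move=> /cvgr0_norm_lt /(_ (k.+1%:R^-1)); rewrite invr_gt0 ltr0n => /(_ isT).
  move=> [N _ /(_ N (leqnn _))] /=; rewrite ger0_norm ?exprn_ge0 // => h.
  by exists N; rewrite -ltr_pdivlMr ?ltr0n // div1r.
have ge0 : 0 <= q ^+ N * k.+1%:R by rewrite mulr_ge0 ?exprn_ge0.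
have [|||x _ xE] := @banach_fixed_point R 'cV[R]_k setT (totalfun (iter N T)).
- exists (NngNum ge0); split => //= -[x y] _ /=.
  apply: le_trans (norm_le_norm2 _) _.
  apply: le_trans (iterq _ _ _) _.
  rewrite -mulrA ler_wpM2l ?exprn_ge0 // (le_trans (norm2_le _)) //.
  by rewrite ler_wpM2r // ler_nat.
- exact: closedT.
- by exists 0.
have {}xE : iter N T x = x := esym xE.
(* [T x] is fixed by the iterate too, so its distance to [x] is at most [q ^+ N < 1] times
   itself. *)
exists x; apply/eqP; rewrite -subr_eq0 -norm2_le0.
have := iterq N (T x) x; rewrite -iterSr iterS xE.
have qN1 : q ^+ N < 1.
  by apply: le_lt_trans qN; rewrite ler_peMr ?exprn_ge0 // ler1n.
by have := norm2_ge0 (T x - x); nra.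
Qed.

(** The step [x - s *: G x] with [s = mu / (L^2 + mu^2)] is a contraction: its squared factor is at
    most [1 - 2 s mu + s^2 L^2 <= 1 - s mu = L^2 / (L^2 + mu^2) < 1]. *)
Lemma strongly_monotone_zero G (mu L : R) : 0 < mu ->
  (forall x y, mu * norm2 (x - y) ^+ 2 <= dot (G x - G y) (x - y)) ->
  lipschitz2 L G -> exists x, G x = 0.
Proof.
move=> mu0 Gmu GL; pose K := L ^+ 2 + mu ^+ 2.
have K0 : 0 < K by rewrite ltr_wpDl ?sqr_ge0 // exprn_gt0.
pose s := mu / K.
have s0 : 0 < s by rewrite divr_gt0.
have sK : s * K = mu by rewrite /s divfK // gt_eqF.
have q2_ge0 : 0 <= L ^+ 2 / K by rewrite divr_ge0 ?sqr_ge0 // ltW.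
have q2_lt1 : L ^+ 2 / K < 1.
  by rewrite ltr_pdivrMr // mul1r /K ltrDl exprn_gt0.
have [||x xE] := @contraction2_fixpoint (fun x => x - s *: G x) (Num.sqrt (L ^+ 2 / K)).
- by rewrite sqrtr_ge0 -sqrtr1 ltr_sqrt.
- move=> x y; rewrite -(@ler_pXn2r _ 2) ?nnegrE ?mulr_ge0 ?norm2_ge0 ?sqrtr_ge0 //.
  rewrite exprMn (sqr_sqrtr q2_ge0).
  have -> : x - s *: G x - (y - s *: G y) = (x - y) - s *: (G x - G y).
    by rewrite scalerBr !opprB addrACA [- (s *: G x) - y]addrC addrACA.
  have := Gmu x y; have := GL x y.
  move: (x - y) (G x - G y) => u v vL muv.
  have v2L : norm2 v ^+ 2 <= L ^+ 2 * norm2 u ^+ 2.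
    by rewrite -exprMn ler_pXn2r ?nnegrE ?norm2_ge0 // (le_trans _ vL) ?norm2_ge0.
  have -> : L ^+ 2 / K = 1 - s * mu.
    rewrite /s; have : K != 0 by rewrite gt_eqF.
    by rewrite /K => ?; field.
  rewrite [in leLHS]sqr_norm2 !dotE (dotC v u) -!sqr_norm2.
  rewrite (dotC v u) in muv.
  have : s ^+ 2 * norm2 v ^+ 2 <= s * mu * norm2 u ^+ 2.
    apply: le_trans (_ : s ^+ 2 * (K * norm2 u ^+ 2) <= _).
      rewrite ler_wpM2l ?sqr_ge0 // (le_trans v2L) // ler_wpM2r ?sqr_ge0 //.
      by rewrite /K lerDl sqr_ge0.
    by rewrite mulrA expr2 -(mulrA s) sK.
  have : s * (mu * norm2 u ^+ 2) <= s * dot u v by rewrite ler_wpM2l // ltW.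
  lra.
- exists x; apply: (scalerI (lt0r_neq0 s0)); rewrite scaler0.
  by apply/eqP; rewrite -oppr_eq0 -(inj_eq (addrI x)) xE addr0.
Qed.

Lemma strongly_convex_monotone F (mu : R) x y : strongly_convex mu F ->
  mu * norm2 (x - y) ^+ 2 <= dot (grad F x - grad F y) (x - y).
Proof.
move=> Fmu; have := Fmu x y; have := Fmu y x.
by rewrite -(opprB x y) norm2N !dotE; lra.
Qed.

(** [get] could return any minimizer [y], but quadratic growth gives [F x + mu / 2 * norm2 (y - x)
    ^+ 2 <= F y <= F x], which forces [y = x]. *)
Lemma strongly_convex_argmin F (mu : R) x : 0 < mu ->
  strongly_convex mu F -> grad F x = 0 -> argmin F = x.
Proof.
move=> mu0 Fmu Fx.
have Fge y : F x + mu / 2 * norm2 (y - x) ^+ 2 <= F y.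
  by have := Fmu x y; rewrite Fx dot0l addr0.
have minx : is_minimizer F x.
  by move=> y; apply: le_trans (Fge y); rewrite lerDl mulr_ge0 ?sqr_ge0 ?divr_ge0 ?ltW.
rewrite /argmin; have /= := getI minx; set y := get _ => /(_ x) yx.
apply/eqP; rewrite -subr_eq0 -norm2_le0 -(@ler_pXn2r _ 2) ?nnegrE ?norm2_ge0 //.
by rewrite expr0n /= -(pmulr_rle0 _ (divr_gt0 mu0 (ltr0n R 2))); have := Fge y; lra.
Qed.

Lemma strongly_convex_grad_argmin F (mu L : R) : 0 < mu ->
  strongly_convex mu F -> smooth L F -> grad F (argmin F) = 0.
Proof.
move=> mu0 Fmu FL.
have [x y|x Fx] := @strongly_monotone_zero (grad F) mu L mu0 _ FL.
  exact: strongly_convex_monotone.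
by rewrite (@strongly_convex_argmin _ mu x).
Qed.

End StrongConvexity.

(** * Directional and partial derivatives, and derivatives along a graph *)

Section Derivatives.
Local Open Scope classical_set_scope.
Local Open Scope ring_scope.
Variable R : realType.

Lemma is_derive_line (U : normedModType R) (F : U -> R) (p q : U) (t : R) :
  differentiable F (p + t *: q) ->
  is_derive t 1 (fun s => F (p + s *: q)) ('D_q F (p + t *: q)).
Proof.
move=> /(@diff_derivable _ _ _ _ _ q) dF.
have E : (fun h : R => h^-1 *: (((fun s => F (p + s *: q)) \o shift t) (h *: 1) -
                           F (p + t *: q))) =
         (fun h => h^-1 *: ((F \o shift (p + t *: q)) (h *: q) - F (p + t *: q))).
  apply/funext => h /=; congr (_ *: (F _ - _)).
  by rewrite [h *: 1]mulr1 scalerDl addrCA.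
by split; rewrite /derivable /derive E.
Qed.

Lemma mean_value_line (U : normedModType R) (F : U -> R) (p q : U) :
  (forall x, differentiable F x) ->
  exists c : R, F (p + q) - F p = 'D_q F (p + c *: q).
Proof.
move=> dF; have dl (t : R) := is_derive_line (dF (p + t *: q)).
have [|c _] := @MVT R _ _ 0 1 ltr01 (fun t _ => dl t).
  apply: derivable_within_continuous => t _.
  by have [] := dl t.
by rewrite scale1r scale0r addr0 subr0 mulr1 => cE; exists c.
Qed.

Lemma derive_partial1 (U V W : normedModType R) (h : U * V -> W) a b u :
  'D_u (fun x => h (x, b)) a = 'D_(u, 0) h (a, b).
Proof.
have E : (fun t : R => t^-1 *: (((fun x => h (x, b)) \o shift a) (t *: u) - h (a, b)))
    = (fun t => t^-1 *: ((h \o shift (a, b)) (t *: ((u, 0) : U * V)) - h (a, b))).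
  apply/funext => t /=.
  have -> // : t *: ((u, 0) : U * V) + (a, b) = (t *: u + a, b).
  by transitivity (t *: u + a, t *: (0 : V) + b) => //; rewrite scaler0 add0r.
by rewrite /derive E.
Qed.

Lemma derive_partial2 (U V W : normedModType R) (h : U * V -> W) a b v :
  'D_v (fun y => h (a, y)) b = 'D_(0, v) h (a, b).
Proof.
have E : (fun t : R => t^-1 *: (((fun y => h (a, y)) \o shift b) (t *: v) - h (a, b)))
    = (fun t => t^-1 *: ((h \o shift (a, b)) (t *: ((0, v) : U * V)) - h (a, b))).
  apply/funext => t /=.
  have -> // : t *: ((0, v) : U * V) + (a, b) = (a, t *: v + b).
  by transitivity (t *: (0 : U) + a, t *: v + b) => //; rewrite scaler0 add0r.
by rewrite /derive E.
Qed.

Lemma differentiable_partial1 (U V W : normedModType R) (h : U * V -> W) a b :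
  differentiable h (a, b) -> differentiable (fun x => h (x, b)) a.
Proof.
move=> dh; exact: (@differentiable_comp _ _ _ _ (fun x => (x, b)) h).
Qed.

Lemma differentiable_partial2 (U V W : normedModType R) (h : U * V -> W) a b :
  differentiable h (a, b) -> differentiable (fun y => h (a, y)) b.
Proof.
move=> dh; exact: (@differentiable_comp _ _ _ _ (fun y => (a, y)) h).
Qed.

Lemma derive_grad k (F : 'cV[R]_k -> R) x u :
  differentiable F x -> 'D_u F x = dot (grad F x) u.
Proof.
move=> dF; rewrite deriveE // {1}(matrix_sum_delta u) linear_sum /dot.
by apply: eq_bigr => i _; rewrite big_ord1 linearZ mxE deriveE // mulrC.
Qed.

(** The matrix is the transposed Jacobian, differentiation index first, as in [hess_vv] and
    [hess_wv]. *)
Lemma grad_dot p q (G : 'cV[R]_p -> 'cV[R]_q) x (z : 'cV[R]_q) :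
  (forall j, differentiable (fun y => G y j 0) x) ->
  grad (fun y => dot (G y) z) x =
  (\matrix_(i < p, j < q) 'D_(delta_mx i 0) (fun y => G y j 0) x) *m z.
Proof.
move=> dG; apply/colP => i; rewrite !mxE.
have -> : (fun y => dot (G y) z) = \sum_(j < q) (z j 0 *: (fun y => G y j 0)).
  apply/funext => y; rewrite fct_sumE; apply: eq_bigr => j _.
  by rewrite mulrC.
rewrite derive_sum => [|j]; last exact/derivableZ/diff_derivable.
apply: eq_bigr => j _; rewrite deriveZ ?mxE; last exact: diff_derivable.
by rewrite mulrC.
Qed.

(** The Lipschitz bound makes the displacement along the graph of order [h], so the remainder of
    [Phi] is still [o(h)]; the vertical part of the displacement is killed by the differential. *)
Lemma derive_graph (U V : normedModType R) (Phi : U * V -> R) (s : U -> V)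
    (C : R) a u :
  differentiable Phi (a, s a) ->
  (forall y, 'D_(0, y) Phi (a, s a) = 0) ->
  (forall x, `|s x - s a| <= C * `|x - a|) ->
  'D_u (fun x => Phi (x, s x)) a = 'D_(u, 0) Phi (a, s a).
Proof.
move=> dPhi d0 sC; rewrite (deriveE _ dPhi) /derive; apply: cvg_lim => //.
(* [K] dominates both [|u|] and [C * |u|], hence both components of the displacement [y] divided by
   [|h|]; the final 1 keeps it positive. *)
pose K := (`|C| + 1) * `|u| + 1.
have K0 : 0 < K by rewrite ltr_wpDl // mulr_ge0 // addr_ge0.
apply/cvgrPdist_le => e e0.
have eK : 0 < e / K by rewrite divr_gt0.
have /eqaddoP/(_ _ eK)/nbhs_normP[d /= dgt0 dle] := diff_locally dPhi.
near=> h.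
have h0 : h != 0 by near: h; exact: nbhs_dnbhs_neq.
have hd : `|h| < d / K.
  near: h; apply: dnbhs0_lt; exact: divr_gt0.
pose y : U * V := (h *: u, s (h *: u + a) - s a).
have yK : `|y| <= K * `|h|.
  rewrite prod_normE /= ge_max; apply/andP; split.
    rewrite normrZ mulrC ler_wpM2r // /K.
    by have := normr_ge0 C; have := normr_ge0 u; nra.
  apply: le_trans (sC _) _; rewrite addrK normrZ mulrCA [leRHS]mulrC ler_wpM2l //.
  by rewrite /K; have := ler_norm C; have := normr_ge0 u; nra.
have ys : y + (a, s a) = (h *: u + a, s (h *: u + a)).
  by transitivity (h *: u + a, (s (h *: u + a) - s a) + s a) => //; rewrite subrK.
have yd : ball_ Num.norm 0 d y.
  by rewrite /ball_ /= sub0r normrN (le_lt_trans yK) // mulrC -ltr_pdivlMr.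
have dy : 'd Phi (a, s a) y = h * 'd Phi (a, s a) (u, 0).
  have -> : y = h *: ((u, 0) : U * V) + (0, s (h *: u + a) - s a).
    transitivity (h *: u + 0, h *: (0 : V) + (s (h *: u + a) - s a)) => //.
    by rewrite addr0 scaler0 add0r.
  by rewrite linearD linearZ -(deriveE (0, _)) // d0 addr0.
have {dle yd} := dle y yd.
rewrite -[X in `|X|]/(Phi (y + (a, s a)) - (Phi (a, s a) + 'd Phi (a, s a) y)) ys dy => bnd.
move: bnd; move: (Phi (h *: u + _, _)) (Phi (a, _)) ('d Phi _ _) => X Y D bnd.
have -> : D - h^-1 *: (X - Y) = - (h^-1 * (X - (Y + h * D))).
  by rewrite -[_ *: _]/(h^-1 * (X - Y)); field.
rewrite normrN normrM normfV mulrC ler_pdivrMr ?normr_gt0 // (le_trans bnd) //.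
by rewrite -mulrA ler_wpM2l ?(ltW e0) // mulrC ler_pdivrMr // mulrC.
Unshelve. all: by end_near. Qed.

End Derivatives.

(** A [sup] bounds its elements only if the set is bounded above. Cauchy-Schwarz on each row
    provides such a bound, the Frobenius norm; then [x] is normalized. *)
Lemma norm2_mulmx_le (R : realType) (p q : nat) (A : 'M[R]_(p, q)) (x : 'cV[R]_q) :
  norm2 (A *m x) <= opnorm2 A * norm2 x.
Proof.
pose C := \sum_(i < p) norm2 (row i A)^T ^+ 2.
have AC (y : 'cV[R]_q) : norm2 (A *m y) <= Num.sqrt C * norm2 y.
  have C0 : 0 <= C by apply: sumr_ge0 => i _; exact: sqr_ge0.
  rewrite -(@ler_pXn2r _ 2) ?nnegrE ?mulr_ge0 ?norm2_ge0 ?sqrtr_ge0 //.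
  rewrite exprMn (sqr_sqrtr C0) sqr_norm2 mulr_suml; apply: ler_sum => i _.
  have -> : (A *m y) i 0 = dot (row i A)^T y.
    by rewrite mxE; apply: eq_bigr => j _; rewrite !mxE.
  rewrite -exprMn -expr2 -real_normK ?num_real // ler_pXn2r ?nnegrE ?mulr_ge0 ?norm2_ge0 //.
  exact: cauchy_schwarz_norm.
have [x0|x0] := eqVneq x 0.
  by rewrite x0 mulmx0 !norm2_0 mulr0.
have nx : 0 < norm2 x by rewrite ltNge norm2_le0.
rewrite -ler_pdivrMr //; apply: sup_ubound.
  exists (Num.sqrt C) => _ [y /= y1 <-]; apply: le_trans (AC y) _.
  by rewrite -[leRHS]mulr1 ler_wpM2l ?sqrtr_ge0.
exists ((norm2 x)^-1 *: x) => /=.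
  by rewrite norm2Z ger0_norm ?invr_ge0 ?norm2_ge0 // mulVf // gt_eqF.
by rewrite -scalemxAr norm2Z ger0_norm ?invr_ge0 ?norm2_ge0 // mulrC.
Qed.

(** * The inner problem: Hessians, the solution map and the gradient of [fstar] *)

Section Bilevel.
Local Open Scope classical_set_scope.
Local Open Scope ring_scope.
Variables (R : realType) (m n : nat) (g : 'cV[R]_m * 'cV[R]_n -> R) (mu L : R).
Hypotheses (mu_gt0 : 0 < mu) (g_C2 : C2 g)
  (g_convex : forall w, strongly_convex mu (fun v => g (w, v)))
  (g_smooth : forall w, smooth L (fun v => g (w, v))).

Lemma grad_vE w v j : grad_v g w v j 0 = 'D_(0, delta_mx j 0) g (w, v).
Proof. by rewrite mxE derive_partial2. Qed.

Lemma differentiable_grad_v j p : differentiable (fun p => grad_v g p.1 p.2 j 0) p.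
Proof.
have -> : (fun p => grad_v g p.1 p.2 j 0) = 'D_(0, delta_mx j 0) g.
  by apply/funext => -[w v]; rewrite grad_vE.
by have [_ /(_ (0, delta_mx j 0)) []] := g_C2.
Qed.

Lemma differentiable_grad_v_dot z p : differentiable (fun p => dot (grad_v g p.1 p.2) z) p.
Proof.
have -> : (fun p => dot (grad_v g p.1 p.2) z) =
    \sum_(j < n) (z j 0 *: (fun p => grad_v g p.1 p.2 j 0)).
  by apply/funext => x; rewrite fct_sumE; apply: eq_bigr => j _; rewrite mulrC.
by apply: differentiable_sum => j; apply: differentiableZ; exact: differentiable_grad_v.
Qed.

Lemma grad_v_dot1 w v z :
  grad (fun w' => dot (grad_v g w' v) z) w = hess_wv g w v *m z.
Proof.
rewrite grad_dot // => j.
exact: (differentiable_partial1 (differentiable_grad_v j (w, v))).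
Qed.

Lemma grad_v_dot2 w v z :
  grad (fun v' => dot (grad_v g w v') z) v = hess_vv g w v *m z.
Proof.
rewrite grad_dot // => j.
exact: (differentiable_partial2 (differentiable_grad_v j (w, v))).
Qed.

Lemma grad_v_vstar w : grad_v g w (vstar g w) = 0.
Proof. exact: strongly_convex_grad_argmin mu_gt0 (g_convex w) (g_smooth w). Qed.

Lemma grad_v_monotone w v v' :
  mu * norm2 (v - v') ^+ 2 <= dot (grad_v g w v - grad_v g w v') (v - v').
Proof. exact: (strongly_convex_monotone v v' (g_convex w)). Qed.

(** The left side bounds from below the difference quotients of [grad_v g] along [z], by strong
    monotonicity. Multiplying by [h ^+ 2] treats both signs of [h] at once. *)
Lemma hess_vv_ge w v z : mu * dot z z <= dot (hess_vv g w v *m z) z.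
Proof.
have dG := differentiable_partial2 (differentiable_grad_v_dot z (w, v)).
rewrite -grad_v_dot2 -derive_grad //.
apply: limr_ge; first exact: (diff_derivable dG).
near=> h.
have h0 : h != 0 by near: h; exact: nbhs_dnbhs_neq.
rewrite /= -dotNl -dotDl.
have := grad_v_monotone w (h *: z + v) v; rewrite addrK sqr_norm2 !dotZl !dotZr.
move: (dot (_ - _) z) => D.
rewrite -[_ *: _]/(h^-1 * D) => hD.
have h2 : 0 < h ^+ 2 by rewrite exprn_even_gt0.
rewrite -(ler_pM2l h2); apply: le_trans (_ : h * D <= _).
  by apply: le_trans hD; rewrite le_eqVlt; apply/orP; left; apply/eqP; ring.
by rewrite le_eqVlt; apply/orP; left; apply/eqP; field.
Unshelve. all: by end_near. Qed.

(** By [hess_vv_ge] the kernel is trivial. Since [kermx] is a left kernel, the argument runs on the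
    transpose. *)
Lemma hess_vv_unit w v : hess_vv g w v \in unitmx.
Proof.
rewrite -unitmx_tr -row_free_unit -kermx_eq0; apply/eqP/row_matrixP => i.
rewrite row0; set r := row i _.
have Ar : hess_vv g w v *m r^T = 0.
  by rewrite -[hess_vv _ _ _]trmxK -trmx_mul -row_mul mulmx_ker row0 trmx0.
apply: trmx_inj; apply/eqP; rewrite trmx0 -norm2_le0 -(@ler_pXn2r _ 2) ?nnegrE ?norm2_ge0 //.
rewrite expr0n /= sqr_norm2 -(pmulr_rle0 _ mu_gt0).
by have := hess_vv_ge w v r^T; rewrite Ar dot0l.
Qed.

Section Lipschitz.
Variable H : R.
Hypotheses (H_ge0 : 0 <= H) (hess_wv_bound : forall w v, opnorm2 (hess_wv g w v) <= H).

(** The mean value theorem is scalar, so it is applied to the component of [grad_v g] along the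
    increment [z] itself; this bounds [norm2 z ^+ 2] by [H * norm2 z * norm2 (w - w')]. *)
Lemma grad_v_lipschitz1 w w' v :
  norm2 (grad_v g w v - grad_v g w' v) <= H * norm2 (w - w').
Proof.
set z := grad_v g w v - _.
have [z0|z0] := leP (norm2 z) 0.
  by apply: le_trans z0 _; rewrite mulr_ge0 ?norm2_ge0.
have dG x := differentiable_partial1 (differentiable_grad_v_dot z (x, v)).
have [c] := mean_value_line w' (w - w') dG.
rewrite /= [w' + (w - w')]addrC subrK -dotNl -dotDl -/z derive_grad // grad_v_dot1.
rewrite -sqr_norm2 => E.
rewrite -(ler_pM2r z0) -expr2 E (le_trans (cauchy_schwarz _ _)) //.
rewrite mulrAC ler_wpM2r ?norm2_ge0 // (le_trans (norm2_mulmx_le _ _)) //.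
by rewrite ler_wpM2r ?norm2_ge0.
Qed.

Lemma vstar_lipschitz w w' :
  norm2 (vstar g w - vstar g w') <= H / mu * norm2 (w - w').
Proof.
set d := vstar g w - _.
have [d0|d0] := leP (norm2 d) 0.
  by apply: le_trans d0 _; rewrite mulr_ge0 ?norm2_ge0 // divr_ge0 // ltW.
have := grad_v_monotone w (vstar g w) (vstar g w').
(* The gradient at [(w, vstar g w)] is zero and is replaced by the one at [(w', vstar g w')], also
   zero; the two remaining gradients then differ only in the outer variable. *)
rewrite grad_v_vstar -(grad_v_vstar w') -/d => h.
rewrite mulrAC ler_pdivlMr // mulrC -(ler_pM2r d0) -mulrA -expr2 (le_trans h) //.
rewrite (le_trans (cauchy_schwarz _ _)) // ler_wpM2r ?norm2_ge0 //.
by rewrite (norm2_distC w) grad_v_lipschitz1.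
Qed.

(* Since [grad_v g] vanishes on the graph of [vstar g], subtracting from [f] the
   adjoint multiple [dot lam (grad_v g)] does not change [fstar]; the choice of
   [lam] kills the derivative in [v], so that [vstar g] only has to be Lipschitz. *)
Lemma grad_fstar (f : 'cV[R]_m * 'cV[R]_n -> R) w : (forall p, differentiable f p) ->
  grad (fstar f g) w = tgrad f g w (vstar g w).
Proof.
move=> df; set v := vstar g w.
pose lam := invmx (hess_vv g w v) *m grad_v f w v.
pose G p := dot (grad_v g p.1 p.2) lam.
have dG p : differentiable G p := differentiable_grad_v_dot lam p.
have dfG p : differentiable (f - G) p by apply: differentiableB.
have dpart (u : 'cV[R]_m * 'cV[R]_n) :
    'D_u (f - G) (w, v) = 'D_u f (w, v) - 'D_u G (w, v).
  by rewrite deriveB //; exact: diff_derivable.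
have fE : fstar f g = fun x => (f - G) (x, vstar g x).
  apply/funext => x; rewrite /fstar -[RHS]/(f _ - G _).
  by rewrite [G _]/G /= grad_v_vstar dot0l subr0.
(* [derive_graph] uses the maximum norm, whence the extra factor [m]. *)
have vC x : `|vstar g x - vstar g w| <= H / mu * m%:R * `|x - w|.
  apply: le_trans (norm_le_norm2 _) _; apply: le_trans (vstar_lipschitz _ _) _.
  by rewrite -[leRHS]mulrA ler_wpM2l ?norm2_le // divr_ge0 // ltW.
have dv0 y : 'D_(0, y) (f - G) (w, v) = 0.
  rewrite dpart -!derive_partial2 !derive_grad; last 2 first.
  - exact: (differentiable_partial2 (dG (w, v))).
  - exact: (differentiable_partial2 (df (w, v))).
  by rewrite grad_v_dot2 mulKVmx ?hess_vv_unit // subrr.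
apply/colP => i; rewrite mxE fE.
rewrite (derive_graph (s := vstar g) (delta_mx i 0) (dfG (w, v)) dv0 vC) dpart.
rewrite -!derive_partial1 !derive_grad; last 2 first.
- exact: (differentiable_partial1 (dG (w, v))).
- exact: (differentiable_partial1 (df (w, v))).
by rewrite grad_v_dot1 !dot_delta /tgrad -mulmxA !mxE.
Qed.

End Lipschitz.
End Bilevel.

(** * One-step estimates for the outer and inner updates *)

Section Steps.
Variables (R : realType) (k : nat).
Implicit Types x y e F r d G s : 'cV[R]_k.

Lemma young x y (t : R) : 0 < t -> 2 * dot x y <= t * dot x x + t^-1 * dot y y.
Proof.
move=> t0; have t'0 : 0 <= t^-1 by rewrite invr_ge0 ltW.
have := mulr_ge0 t'0 (dot_ge0 (t *: x - y)).
rewrite !dotE (dotC y x) => h; rewrite -subr_ge0 (le_trans h) //.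
by rewrite le_eqVlt; apply/orP; left; apply/eqP; field; rewrite gt_eqF.
Qed.

Lemma sqr_norm2D_le x y : norm2 (x + y) ^+ 2 <= 2 * norm2 x ^+ 2 + 2 * norm2 y ^+ 2.
Proof.
have := young x y ltr01; rewrite invr1 !sqr_norm2 !dotE (dotC y x); lra.
Qed.

(** [F] stands for the exact gradient and [r] for its error. Young's inequality with parameter
    [mu / 2] on the cross term of [e] and [r] costs [a * mu / 2] out of the gain [2 * a * mu]. *)
Lemma outer_step e F r (a mu : R) : 0 < a -> 0 < mu ->
  mu * norm2 e ^+ 2 <= dot F e ->
  norm2 (e - a *: (F + r)) ^+ 2 <=
    (1 - 3 / 2 * a * mu) * norm2 e ^+ 2 + 2 * a ^+ 2 * norm2 F ^+ 2 +
    (2 * a / mu + 2 * a ^+ 2) * norm2 r ^+ 2.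
Proof.
move=> a0 mu0 muF.
have aFr : a ^+ 2 * norm2 (F + r) ^+ 2 <= a ^+ 2 * (2 * norm2 F ^+ 2 + 2 * norm2 r ^+ 2).
  by rewrite ler_wpM2l ?sqr_ge0 // sqr_norm2D_le.
have := young e (- r) (divr_gt0 mu0 (ltr0n R 2)); rewrite !dotE opprK -!sqr_norm2 => re.
have {}re := ler_wpM2l (ltW a0) re.
have {}muF := ler_wpM2l (ltW a0) muF.
have -> : norm2 (e - a *: (F + r)) ^+ 2 =
    norm2 e ^+ 2 - 2 * (a * dot F e) + a * (2 * - dot e r) + a ^+ 2 * norm2 (F + r) ^+ 2.
  by rewrite !sqr_norm2 !dotE !(dotC e) (dotC r F); ring.
have -> : 2 * a / mu = a * (mu / 2)^-1 by field; rewrite gt_eqF.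
lra.
Qed.

(** A gradient step shrinks [d], and the drift [s] is split off by Young's inequality with parameter
    [b * mu / 2]. *)
Lemma inner_step d G s (b mu L : R) : 0 < b -> 0 < mu ->
  mu * norm2 d ^+ 2 <= dot G d -> norm2 G ^+ 2 <= L ^+ 2 * norm2 d ^+ 2 ->
  norm2 (d - b *: G + s) ^+ 2 <=
    (1 + b * mu / 2) * (1 - 2 * b * mu + b ^+ 2 * L ^+ 2) * norm2 d ^+ 2 +
    (1 + 2 / (b * mu)) * norm2 s ^+ 2.
Proof.
move=> b0 mu0 muG GL; set p := d - b *: G.
have t0 : 0 < b * mu / 2 by rewrite divr_gt0 ?mulr_gt0.
have p2 : norm2 p ^+ 2 <= (1 - 2 * b * mu + b ^+ 2 * L ^+ 2) * norm2 d ^+ 2.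
  have {}GL := ler_wpM2l (sqr_ge0 b) GL; have {}muG := ler_wpM2l (ltW b0) muG.
  have -> : norm2 p ^+ 2 = norm2 d ^+ 2 - 2 * (b * dot G d) + b ^+ 2 * norm2 G ^+ 2.
    by rewrite !sqr_norm2 /p !dotE (dotC d G); ring.
  lra.
have {}p2 := ler_wpM2l (_ : 0 <= 1 + b * mu / 2) p2.
have := young p s t0.
have -> : (b * mu / 2)^-1 = 2 / (b * mu) by rewrite invf_div.
move: p2; rewrite !sqr_norm2 (dotDl p s) !(dotDr _ p s) (dotC s p) => p2 ys.
have := p2 (addr_ge0 ler01 (ltW t0)); lra.
Qed.

End Steps.

(** * Scalar inequalities behind the rate *)

Section Rate.
Variables (R : realType) (a b muf mug L C Hv H : R).
Hypotheses (a0 : 0 < a) (b0 : 0 < b) (muf0 : 0 < muf) (mug0 : 0 < mug)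
  (Hv0 : 0 < Hv) (H0 : 0 < H) (C0 : 0 < C).
Hypotheses (aC : 8 * C * a <= muf) (amuf : 24 * muf * a <= 1) (bmug : 4 * mug * b <= 1)
  (ratio : 81 * Hv ^+ 2 * H ^+ 2 * a <= 2 * muf * mug ^+ 4 * b ^+ 2).

Let P : R := 2 / 3 * mug ^+ 3 * b / H ^+ 2.

(** This is the weighted cost of the drift of [vstar g]. The choice of [P] reduces it to
    [2 / 3 * (b * mug + 2)], and [b * mug <= 1 / 4] yields exactly [3 / 2]. *)
Lemma weight_bound : P * (1 + 2 / (b * mug)) * (H / mug) ^+ 2 <= 3 / 2.
Proof.
have -> : P * (1 + 2 / (b * mug)) * (H / mug) ^+ 2 = 2 / 3 * (b * mug + 2).
  by rewrite /P; field; rewrite !gt_eqF.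
by move: bmug; lra.
Qed.

(** The terms in [C] sum to at most [10 * C * a ^+ 2], of which the target rate allows 6; the other
    4 fit into the spare [3 / 4 * a * muf] because [8 * C * a <= muf]. *)
Lemma outer_rate :
  1 - 3 / 2 * a * muf + 4 * C * a ^+ 2 +
    P * (1 + 2 / (b * mug)) * (H / mug) ^+ 2 * a ^+ 2 * (4 * C) <=
  1 - 3 * muf * a / 4 * (1 - 8 * C * a / muf).
Proof.
have -> : 3 * muf * a / 4 * (1 - 8 * C * a / muf) = 3 / 4 * muf * a - 6 * C * a ^+ 2.
  by field; rewrite gt_eqF.
have aC0 : 0 <= a ^+ 2 * (4 * C) by rewrite mulr_ge0 ?sqr_ge0 // mulr_ge0 // ltW.
have := ler_wpM2r aC0 weight_bound; rewrite (mulrA _ (a ^+ 2)).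
have := ler_wpM2l (ltW a0) aC; have := mulr_gt0 a0 muf0; lra.
Qed.

(** The coupling terms total at most [(2 + 5 / 24) * t * Hv ^+ 2] with [t = a / muf], which is below
    [P * (b * mug) / 10]; the slack in the inner rate is [P * (b * mug)]. *)
Lemma inner_rate :
  (2 * a / muf + 2 * a ^+ 2) * Hv ^+ 2 +
    P * ((1 + b * mug / 2) * (1 - 2 * b * mug + b ^+ 2 * L ^+ 2)) +
    P * (1 + 2 / (b * mug)) * (H / mug) ^+ 2 * a ^+ 2 * (2 * Hv ^+ 2) <=
  P * (1 - mug * b / 2 * (1 - 4 * L ^+ 2 * b / mug)).
Proof.
have P0 : 0 < P by rewrite /P !(divr_gt0, mulr_gt0, exprn_gt0).
pose t := a / muf; have t0 : 0 < t by rewrite divr_gt0.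
have at_ : a = t * muf by rewrite /t divfK // gt_eqF.
have a2t : a ^+ 2 <= t / 24.
  have -> : a ^+ 2 = t * (muf * a) by rewrite expr2 {1}at_ mulrA.
  by rewrite ler_wpM2l ?(ltW t0) //; move: amuf; lra.
have Hv2 : 0 < Hv ^+ 2 by rewrite exprn_gt0.
(* This is the bound on [a / b ^+ 2], rewritten in terms of [P]. *)
have tHv : t * Hv ^+ 2 <= P * (b * mug) / 27.
  have -> : P * (b * mug) / 27 = (2 * muf * mug ^+ 4 * b ^+ 2) / (81 * H ^+ 2 * muf).
    by rewrite /P; field; rewrite !gt_eqF.
  rewrite ler_pdivlMr ?(mulr_gt0, exprn_gt0) //.
  apply: le_trans ratio; rewrite at_ le_eqVlt; apply/orP; left; apply/eqP; ring.
have -> : 2 * a / muf = 2 * t by rewrite /t mulrA.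
have w1 := ler_wpM2r (mulr_ge0 (sqr_ge0 a) (mulr_ge0 (ler0n R 2) (ltW Hv2))) weight_bound.
rewrite mulrA in w1.
have w2 := ler_wpM2r (ltW Hv2) a2t.
have slack : P * ((1 + b * mug / 2) * (1 - 2 * b * mug + b ^+ 2 * L ^+ 2)) + P * (b * mug)
    <= P * (1 - mug * b / 2 * (1 - 4 * L ^+ 2 * b / mug)).
  rewrite -mulrDr ler_wpM2l ?(ltW P0) //.
  have -> : mug * b / 2 * (1 - 4 * L ^+ 2 * b / mug) = mug * b / 2 - 2 * (b * L) ^+ 2.
    by field; rewrite gt_eqF.
  have := sqr_ge0 (b * L); have := sqr_ge0 (b * mug); have := mulr_gt0 b0 mug0.
  rewrite -exprMn; move: ((b * L) ^+ 2) => q; move: bmug; nra.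
have := mulr_gt0 P0 (mulr_gt0 b0 mug0); lra.
Qed.

End Rate.

(** * Linear convergence of the single-loop iteration *)

Theorem theorem1 (R : realType) (m n : nat)
    (f g : 'cV[R]_m * 'cV[R]_n -> R)
    (mu_g L_g mu_f H_w H_v H alpha beta : R)
    (hmu_g : 0 < mu_g) (hL_g : 0 < L_g) (hmu_f : 0 < mu_f)
    (hH_w : 0 < H_w) (hH_v : 0 < H_v) (hH : 0 < H)
    (f_C1 : C1 f) (g_C2 : C2 g)
    (* (A1) *)
    (g_convex : forall w, strongly_convex mu_g (fun v => g (w, v)))
    (g_smooth : forall w, smooth L_g (fun v => g (w, v)))
    (* (A2) *)
    (fstar_convex : strongly_convex mu_f (fstar f g))
    (tgrad_lip_w : forall v, lipschitz2 H_w (fun w => tgrad f g w v))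
    (tgrad_lip_v : forall w, lipschitz2 H_v (fun v => tgrad f g w v))
    (* (A3) *)
    (hess_wv_bound : forall w v, opnorm2 (hess_wv g w v) < H)
    (halpha : 0 < alpha) (hbeta : 0 < beta)
    (halpha_lt : alpha <
       Num.min (mu_f / (8 * (H_w ^+ 2 + 2 * H_v ^+ 2 * H ^+ 2 / mu_g ^+ 2)))
               (1 / (24 * mu_f)))
    (hbeta_lt : beta < Num.min (mu_g / (8 * L_g ^+ 2)) (1 / (4 * mu_g)))
    (hratio : alpha / beta ^+ 2 <
       2 * mu_f * mu_g ^+ 4 / (81 * H_v ^+ 2 * H ^+ 2)) :
  let wopt := argmin (fstar f g) in
  exists rho c_w c_v : R,
    [/\ 0 < rho < 1,
        rho <= Num.max
          (Num.sqrt (1 - 3 * mu_f * alpha / 4 *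
             (1 - 8 * (H_w ^+ 2 + 2 * (H_v ^+ 2 * H ^+ 2 / mu_g ^+ 2)) * alpha
                  / mu_f)))
          (Num.sqrt (1 - mu_g * beta / 2 * (1 - 4 * L_g ^+ 2 * beta / mu_g))),
        0 < c_w, 0 < c_v &
        forall (w : nat -> 'cV[R]_m) (v : nat -> 'cV[R]_n),
          (forall k, w k.+1 = w k - alpha *: tgrad f g (w k) (v k)) ->
          (forall k, v k.+1 = v k - beta *: grad_v g (w k) (v k)) ->
          forall k,
            norm2 (w k - wopt) <= c_w * rho ^+ k *
              (norm2 (w 0%N - wopt) + norm2 (v 0%N - vstar g (w 0%N))) /\
            norm2 (v k - vstar g wopt) <= c_v * rho ^+ k *
              (norm2 (w 0%N - wopt) + norm2 (v 0%N - vstar g (w 0%N)))].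
Proof.
move=> wopt.
move: halpha_lt hbeta_lt; rewrite !lt_min => /andP[aC aM] /andP[bL bM].
pose C := H_w ^+ 2 + 2 * (H_v ^+ 2 * H ^+ 2 / mu_g ^+ 2).
have C0 : 0 < C by rewrite /C !(addr_gt0, mulr_gt0, invr_gt0, exprn_gt0).
have CE : H_w ^+ 2 + 2 * H_v ^+ 2 * H ^+ 2 / mu_g ^+ 2 = C by rewrite /C !mulrA.
have {}aC : 8 * C * alpha < mu_f.
  by move: aC; rewrite CE ltr_pdivlMr 1?mulrC // mulr_gt0.
have {}aM : 24 * mu_f * alpha <= 1.
  by move: aM; rewrite ltr_pdivlMr ?mulr_gt0 // mulrC => /ltW.
have {}bL : 8 * L_g ^+ 2 * beta < mu_g.
  by move: bL; rewrite ltr_pdivlMr 1?mulrC // mulr_gt0 ?exprn_gt0.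
have {}bM : 4 * mu_g * beta <= 1.
  by move: bM; rewrite ltr_pdivlMr ?mulr_gt0 // mulrC => /ltW.
have ratio : 81 * H_v ^+ 2 * H ^+ 2 * alpha <= 2 * mu_f * mu_g ^+ 4 * beta ^+ 2.
  move: hratio; rewrite ltr_pdivrMr ?exprn_gt0 // mulrAC.
  by rewrite ltr_pdivlMr 1?mulrC ?mulr_gt0 ?exprn_gt0 // => /ltW.
have hessH w v : opnorm2 (hess_wv g w v) <= H by exact/ltW.
have gradF w : grad (fstar f g) w = tgrad f g w (vstar g w).
  exact: (grad_fstar hmu_g g_C2 g_convex g_smooth (ltW hH) hessH _ (f_C1.1)).
have vsL := vstar_lipschitz hmu_g g_C2 g_convex g_smooth (ltW hH) hessH.
(* Lipschitz constant of the gradient of [fstar]: direct dependence on [w] plus dependence through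
   [vstar g]. It yields the stationarity of [wopt] and, below, the bound on [F]. *)
pose l := H_w + H_v * (H / mu_g).
have Hm0 : 0 <= H / mu_g by rewrite ltW // divr_gt0.
have l0 : 0 <= l.
  by apply/ltW/addr_gt0 => //; apply: mulr_gt0 => //; exact: divr_gt0.
have FL : smooth l (fstar f g).
  move=> w w'; rewrite !gradF /l mulrDl.
  have tw := tgrad_lip_w (vstar g w) w w'.
  have tv := tgrad_lip_v w' (vstar g w) (vstar g w').
  have tri := ler_norm2_dist (tgrad f g w (vstar g w)) (tgrad f g w' (vstar g w))
    (tgrad f g w' (vstar g w')).
  apply: le_trans tri (lerD tw _).
  by rewrite -mulrA (le_trans tv) //; apply: ler_wpM2l (vsL w w'); exact: ltW.
have F0 : grad (fstar f g) wopt = 0 := strongly_convex_grad_argmin hmu_f fstar_convex FL.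
(* [A] and [B] are the squares of the two rates; the strict bounds on [8 * C * alpha] and
   [8 * L_g ^+ 2 * beta] put them below 1. *)
set A := 1 - 3 * mu_f * alpha / 4 * _; set B := 1 - mu_g * beta / 2 * _.
have A01 : 0 < A < 1.
  have -> : A = 1 - (3 / 4 * (mu_f * alpha) - 6 * C * alpha ^+ 2).
    by rewrite /A -/C; field; rewrite gt_eqF.
  have := ltr_pM2l halpha (8 * C * alpha) mu_f; rewrite aC.
  have := mulr_gt0 C0 (exprn_gt0 2 halpha); have := mulr_gt0 hmu_f halpha.
  move=> h1 h2 h3; apply/andP; split; lra.
have B01 : 0 < B < 1.
  have -> : B = 1 - (mu_g * beta / 2 - 2 * L_g ^+ 2 * beta ^+ 2).
    by rewrite /B; field; rewrite gt_eqF.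
  have := ltr_pM2l hbeta (8 * L_g ^+ 2 * beta) mu_g; rewrite bL.
  have := sqr_ge0 (L_g * beta); have := mulr_gt0 hmu_g hbeta; rewrite exprMn.
  move=> h1 h2 h3; apply/andP; split; lra.
move: A01 B01 => /andP[A0 A1] /andP[B0 B1].
pose rho := Num.max (Num.sqrt A) (Num.sqrt B).
have rho0 : 0 < rho by rewrite /rho lt_max sqrtr_gt0 A0.
have rho1 : rho < 1 by rewrite /rho gt_max -sqrtr1 !ltr_sqrt // A1 B1.
have Arho : A <= rho ^+ 2.
  rewrite -(sqr_sqrtr (ltW A0)) ler_pXn2r ?nnegrE ?sqrtr_ge0 ?(ltW rho0) //.
  by rewrite le_max lexx.
have Brho : B <= rho ^+ 2.
  rewrite -(sqr_sqrtr (ltW B0)) ler_pXn2r ?nnegrE ?sqrtr_ge0 ?(ltW rho0) //.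
  by rewrite le_max lexx orbT.
pose P := 2 / 3 * mu_g ^+ 3 * beta / H ^+ 2.
have P0 : 0 < P by rewrite /P !(divr_gt0, mulr_gt0, exprn_gt0).
have iP0 : 0 < P^-1 by rewrite invr_gt0.
have P1 : 0 < 1 + P by exact: addr_gt0.
have iP1 : 0 < 1 + P^-1 by exact: addr_gt0.
(* The first two summands of [c_v] control the distance from [v k] to [vstar g (w k)]; the last one
   is the Lipschitz constant of [vstar g] times [c_w]. *)
exists rho, (1 + P), (1 + P^-1 + H / mu_g * (1 + P)); split => //.
- by rewrite rho0.
- by apply: addr_gt0 => //; apply: mulr_gt0 => //; exact: divr_gt0.
move=> w v wS vS.
pose e k := w k - wopt; pose d k := v k - vstar g (w k).
pose V k := norm2 (e k) ^+ 2 + P * norm2 (d k) ^+ 2.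
have VS k : V k.+1 <= rho ^+ 2 * V k.
  pose F := grad (fstar f g) (w k).
  pose r := tgrad f g (w k) (v k) - F.
  have wk : w k.+1 = w k - alpha *: (F + r) by rewrite wS /r [F + _]addrC subrK.
  have muF : mu_f * norm2 (e k) ^+ 2 <= dot F (e k).
    by have := strongly_convex_monotone (w k) wopt fstar_convex; rewrite F0 subr0.
  (* With [q = H_v * H / mu_g], one has [l^2 = (H_w + q)^2 <= 2 H_w^2 + 2 q^2 <= 2 C]. *)
  have F2 : norm2 F ^+ 2 <= 2 * C * norm2 (e k) ^+ 2.
    apply: le_trans (_ : l ^+ 2 * norm2 (e k) ^+ 2 <= _).
      rewrite -exprMn ler_pXn2r ?nnegrE ?(mulr_ge0 l0) ?norm2_ge0 //.
      by have := FL (w k) wopt; rewrite F0 subr0.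
    rewrite ler_wpM2r ?sqr_ge0 // /l /C.
    have -> : H_v ^+ 2 * H ^+ 2 / mu_g ^+ 2 = (H_v * (H / mu_g)) ^+ 2.
      by rewrite !exprMn exprVn mulrA.
    have := sqr_ge0 (H_w - H_v * (H / mu_g)); have := sqr_ge0 (H_v * (H / mu_g)).
    move: (H_v * _) => q; lra.
  have r2 : norm2 r ^+ 2 <= H_v ^+ 2 * norm2 (d k) ^+ 2.
    rewrite -exprMn ler_pXn2r ?nnegrE ?mulr_ge0 ?norm2_ge0 ?(ltW hH_v) //.
    by rewrite /r /F gradF; exact: tgrad_lip_v.
  pose s := vstar g (w k) - vstar g (w k.+1).
  have s2 : norm2 s ^+ 2 <= (H / mu_g) ^+ 2 * (alpha ^+ 2 *
      (4 * C * norm2 (e k) ^+ 2 + 2 * H_v ^+ 2 * norm2 (d k) ^+ 2)).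
    apply: le_trans (_ : (H / mu_g) ^+ 2 * (alpha ^+ 2 * norm2 (F + r) ^+ 2) <= _).
      rewrite -!exprMn ler_pXn2r ?nnegrE ?(mulr_ge0 Hm0) ?mulr_ge0 ?norm2_ge0 ?(ltW halpha) //.
      apply: le_trans (vsL _ _) _; rewrite wk opprB addrC subrK norm2Z gtr0_norm //.
    rewrite !ler_wpM2l ?sqr_ge0 // (le_trans (sqr_norm2D_le _ _)) //; lra.
  pose G := grad_v g (w k) (v k).
  have dk : d k.+1 = d k - beta *: G + s.
    by rewrite /d vS /s (addrAC (v k) (- vstar g (w k))) addrA subrK.
  have muG : mu_g * norm2 (d k) ^+ 2 <= dot G (d k).
    have := grad_v_monotone g_convex (w k) (v k) (vstar g (w k)).
    by rewrite (grad_v_vstar hmu_g g_convex g_smooth) subr0.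
  have G2 : norm2 G ^+ 2 <= L_g ^+ 2 * norm2 (d k) ^+ 2.
    rewrite -exprMn ler_pXn2r ?nnegrE ?mulr_ge0 ?norm2_ge0 ?(ltW hL_g) //.
    have := g_smooth (w k) (v k) (vstar g (w k)).
    by rewrite -!/(grad_v g _ _) (grad_v_vstar hmu_g g_convex g_smooth) subr0.
  have ek : e k.+1 = e k - alpha *: (F + r) by rewrite /e wk addrAC.
  have := outer_step r halpha hmu_f muF; rewrite -ek => eS.
  have := inner_step s hbeta hmu_g muG G2; rewrite -dk => dS.
  have t0 : 0 <= 2 * alpha / mu_f + 2 * alpha ^+ 2.
    by rewrite addr_ge0 // ?mulr_ge0 ?sqr_ge0 ?invr_ge0 // ltW.
  have W0 : 0 <= P * (1 + 2 / (beta * mu_g)).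
    apply: mulr_ge0; first exact: ltW.
    by rewrite addr_ge0 // divr_ge0 // ltW // mulr_gt0.
  have x0 := sqr_ge0 (norm2 (e k)); have y0 := sqr_ge0 (norm2 (d k)).
  have oR := ler_wpM2r x0 (outer_rate halpha hbeta hmu_f hmu_g hH C0 (ltW aC) bM).
  have iR := ler_wpM2r y0 (inner_rate L_g halpha hbeta hmu_f hmu_g hH_v hH aM bM ratio).
  have {}F2 := ler_wpM2l (mulr_ge0 (ler0n R 2) (sqr_ge0 alpha)) F2.
  have {}r2 := ler_wpM2l t0 r2; have {}s2 := ler_wpM2l W0 s2.
  have {}dS := ler_wpM2l (ltW P0) dS.
  have Ax := ler_wpM2r x0 Arho; have Bx := ler_wpM2r (mulr_ge0 (ltW P0) y0) Brho.
  rewrite -/P -/A in oR; rewrite -/P -/B in iR; rewrite /V.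
  (* Adding [eS] and the weighted [dS] and eliminating [F], [r] and [s] leaves coefficients of [x]
     and [y] bounded by [oR] and [iR]; with the quantities made opaque this is a linear
     combination. *)
  move: F2 r2 s2 eS dS oR iR Ax Bx.
  move: (norm2 (e k.+1) ^+ 2) (norm2 (d k.+1) ^+ 2) (norm2 (e k) ^+ 2) (norm2 (d k) ^+ 2).
  move: (norm2 r ^+ 2) (norm2 s ^+ 2) (norm2 F ^+ 2) => r' s' F' x1 y1 x y.
  move: (P) (A) (B) (2 * alpha / mu_f) (2 / (beta * mu_g)) (H / mu_g) => P' A' B' t W h.
  lra.
have VB k : V k <= (rho ^+ k) ^+ 2 * V 0%N.
  elim: k => [|k IH]; first by rewrite expr0 expr1n mul1r.
  rewrite (le_trans (VS k)) // (exprS rho k) (exprMn 2 rho) -(mulrA (rho ^+ 2)).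
  exact: ler_wpM2l (sqr_ge0 _) _ _ IH.
move=> k; pose S := norm2 (e 0%N) + norm2 (d 0%N).
have S0 : 0 <= S by rewrite addr_ge0 ?norm2_ge0.
have V0S : V 0%N <= (1 + P) * S ^+ 2.
  rewrite /V /S; have := norm2_ge0 (e 0%N); have := norm2_ge0 (d 0%N).
  move: (norm2 (e _)) (norm2 (d _)) => x y y0 x0.
  have := mulr_ge0 (mulr_ge0 x0 y0) (ltW P0); have := mulr_ge0 x0 y0.
  have := mulr_ge0 (ltW P0) (sqr_ge0 x); have := sqr_ge0 y.
  by move: (P) => P'; lra.
have rS0 : 0 <= rho ^+ k * S by apply: mulr_ge0 => //; rewrite exprn_ge0 ?(ltW rho0).
have VkS : V k <= (1 + P) * (rho ^+ k * S) ^+ 2.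
  apply: le_trans (VB k) _; rewrite exprMn mulrCA ler_wpM2l ?sqr_ge0 //.
(* Enlarging [1 + P] to its square avoids a root in the constant; [1 + P^-1] plays the same role for
   [d] after division by [P]. *)
have ek : norm2 (e k) <= (1 + P) * (rho ^+ k * S).
  rewrite -(@ler_pXn2r _ 2) ?nnegrE ?norm2_ge0 ?(mulr_ge0 _ rS0) ?(ltW P1) //.
  rewrite exprMn; apply: le_trans (_ : V k <= _).
    by rewrite lerDl mulr_ge0 ?sqr_ge0 ?(ltW P0).
  apply: le_trans VkS _; rewrite ler_wpM2r ?sqr_ge0 //.
  by rewrite expr2 ler_peMr ?(ltW P1) // lerDl ltW.
have dk : norm2 (d k) <= (1 + P^-1) * (rho ^+ k * S).
  rewrite -(@ler_pXn2r _ 2) ?nnegrE ?norm2_ge0 ?(mulr_ge0 _ rS0) ?(ltW iP1) //.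
  rewrite exprMn -(ler_pM2l P0); apply: le_trans (_ : V k <= _).
    by rewrite lerDr sqr_ge0.
  apply: le_trans VkS _; rewrite (mulrA P) ler_wpM2r ?sqr_ge0 //.
  have -> : P * (1 + P^-1) ^+ 2 = (1 + P) * (1 + P^-1) by field; rewrite gt_eqF.
  by rewrite ler_peMr ?(ltW P1) // lerDl ltW.
rewrite -(mulrA (1 + P)) -(mulrA (1 + P^-1 + _)); split; first exact: ek.
apply: le_trans (ler_norm2_dist _ (vstar g (w k)) _) _.
rewrite mulrDl lerD // (le_trans (vsL _ _)) // -(mulrA (H / mu_g)).
exact: ler_wpM2l Hm0 _ _ ek.
Qed.
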